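(* The normed space $(\mathcal{LP}[0,1],\|\cdot\|_{[0,1]})$ is not complete.
   Context: Laplace integral on $[a,b]$: with lower/upper Laplace derivates $\underline{LD}_1F(x)$, $\overline{LD}_1F(x)$ being the minimum of the $\liminf$'s, resp. maximum of the $\limsup$'s, as $s\to\infty$ of $s^2\int_0^\delta e^{-st}[F(x+t)-F(x)]dt$ and $(-s^2)\int_0^\delta e^{-st}[F(x-t)-F(x)]dt$ (one-sided at endpoints), a major function of $f$ is a continuous $U$ with $\underline{LD}_1U\geqslant f$, $\underline{LD}_1U>-\infty$ everywhere on $[a,b]$, a minor function a continuous $V$ with $\overline{LD}_1V\leqslant f$, $\overline{LD}_1V<\infty$ everywhere, and $f$ is Laplace integrable if $\sup_V(V(b)-V(a))=\inf_U(U(b)-U(a))$ is finite, this value being $\int_a^bf$. $\mathcal{LP}[a,b]$ denotes the space of Laplace integrable functions on $[a,b]$ modulo equality almost everywhere, with the Alexiewicz norm $\|f\|_{[a,b]}=\sup_{x\in[a,b]}\left|\int_a^xf\right|$. *)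

(* Defs.v *)
From HB Require Import structures.
From mathcomp Require Import all_boot all_order all_algebra.
From mathcomp Require Import all_classical all_reals all_analysis.
Set Implicit Arguments. Unset Strict Implicit. Unset Printing Implicit Defensive.
Import Order.TTheory GRing.Theory Num.Theory.
Import numFieldNormedType.Exports.
Local Open Scope classical_set_scope.
Local Open Scope ring_scope.

Section Laplace.
Variable R : realType.

Definition lap_right (F : R -> R) (x delta s : R) : R :=
  s ^+ 2 * (\int[@lebesgue_measure R]_(t in `[0, delta]) (expR (- (s * t)) * (F (x + t) - F x))).

Definition lap_left (F : R -> R) (x delta s : R) : R :=
  - s ^+ 2 * (\int[@lebesgue_measure R]_(t in `[0, delta]) (expR (- (s * t)) * (F (x - t) - F x))).

Definition liminf_pinfty (g : R -> R) : \bar R :=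
  limf_einf (fun s => (g s)%:E) (pinfty_nbhs R).
Definition limsup_pinfty (g : R -> R) : \bar R :=
  limf_esup (fun s => (g s)%:E) (pinfty_nbhs R).

(* The parameter delta: since the functions involved are continuous (hence
   bounded) on [a,b], the limits do not depend on delta > 0; we fix the
   largest admissible delta keeping x +- t inside [a,b]. *)

Definition lowerLD (a b : R) (F : R -> R) (x : R) : \bar R :=
  if x == a then liminf_pinfty (lap_right F x (b - a))
  else if x == b then liminf_pinfty (lap_left F x (b - a))
  else Order.min (liminf_pinfty (lap_right F x (Order.min (x - a) (b - x))))
                 (liminf_pinfty (lap_left F x (Order.min (x - a) (b - x)))).

Definition upperLD (a b : R) (F : R -> R) (x : R) : \bar R :=
  if x == a then limsup_pinfty (lap_right F x (b - a))
  else if x == b then limsup_pinfty (lap_left F x (b - a))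
  else Order.max (limsup_pinfty (lap_right F x (Order.min (x - a) (b - x))))
                 (limsup_pinfty (lap_left F x (Order.min (x - a) (b - x)))).

Definition major (a b : R) (f U : R -> R) : Prop :=
  {within `[a, b], continuous U} /\
  (forall x, x \in `[a, b] -> ((f x)%:E <= lowerLD a b U x)%E /\ (-oo < lowerLD a b U x)%E).

Definition minor (a b : R) (f V : R -> R) : Prop :=
  {within `[a, b], continuous V} /\
  (forall x, x \in `[a, b] -> (upperLD a b V x <= (f x)%:E)%E /\ (upperLD a b V x < +oo)%E).

Definition lap_sup (a b : R) (f : R -> R) : \bar R :=
  ereal_sup [set ((V b - V a)%:E) | V in [set V | minor a b f V]].
Definition lap_inf (a b : R) (f : R -> R) : \bar R :=
  ereal_inf [set ((U b - U a)%:E) | U in [set U | major a b f U]].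

Definition LP_integrable (a b : R) (f : R -> R) : Prop :=
  exists r : R, lap_sup a b f = r%:E /\ lap_inf a b f = r%:E.

Definition LP_integral (a b : R) (f : R -> R) : R := fine (lap_inf a b f).

(* Alexiewicz (semi)norm  sup_{x in [a,b]} |int_a^x f|
   (the point x = a contributes |int_a^a f| = 0, which does not change the
   supremum of nonnegative quantities, so it is omitted) *)
Definition alex_norm (a b : R) (f : R -> R) : \bar R :=
  ereal_sup [set ((`| LP_integral a x f |)%:E) | x in `]a, b]].

End Laplace.

(* Main.v *)
(** The Laplace primitives of the [wsum' n] are the partial sums [wsum n] of a
    Weierstrass series, which converge uniformly, so the sequence is Cauchy.
    Suppose it converges to some integrable [g], with a major function [U] and a
    minor function [V].  In the limit the increments of [wsum n] are squeezed
    between those of [V] and those of [U].  A major function has a lower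
    Laplace derivate above [-oo] at every point; by Baire category this bound is
    uniform on some subinterval, where therefore [U x - M * x] is nondecreasing
    for some constant [M]; the same holds for [- V] on a smaller subinterval.
    At a point where [U x - V x - c * x] is maximal, with [c] large, the
    increments of both [U] and [V] to the right are then bounded by a multiple
    of the step, hence so are those of the Weierstrass function, which is
    nowhere one-sidedly Lipschitz. *)

Require Import Defs.
From HB Require Import structures.
From mathcomp Require Import all_boot all_order all_algebra.
From mathcomp Require Import all_classical all_reals all_analysis.
From mathcomp Require Import ring lra.
Set Implicit Arguments.
Unset Strict Implicit.
Unset Printing Implicit Defensive.
Import Order.TTheory GRing.Theory Num.Theory.
Import numFieldNormedType.Exports.
Local Open Scope classical_set_scope.
Local Open Scope ring_scope.

(** * Truncated Laplace transforms and their asymptotic lower bounds *)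

Section LaplaceTransform.
Variable R : realType.
Implicit Types (psi F : R -> R) (c d s : R).
Local Notation mu := (@lebesgue_measure R).

(** The factor [s ^+ 2] normalises the transform so that [psi = id] gives values tending to 1;
    applied to the increments of a function, it plays the role of a difference quotient. *)
Definition lap d psi s : R :=
  s ^+ 2 * \int[mu]_(t in `[0, d]) (expR (- (s * t)) * psi t).

(** The inequality [c <= liminf] of [lap d psi], in a form free of extended reals. *)
Definition lap_ge d psi c : Prop :=
  forall e : R, 0 < e -> \forall s \near +oo, c - e <= lap d psi s.

Lemma Rintegral_antiderivative (F f : R -> R) d : 0 < d -> continuous f ->
  (forall x : R, is_derive x (1 : R) F (f x)) ->
  \int[mu]_(t in `[0, d]) f t = F d - F 0.
Proof.
move=> d0 cf dF; rewrite /Rintegral (@continuous_FTC2 _ f F)//.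
- exact/continuous_subspaceT.
- have cF : continuous F.
    move=> x; apply/differentiable_continuous/derivable1_diffP.
    by case: (dF x).
  split.
  + by move=> x _; case: (dF x).
  + exact/cvg_at_right_filter/cF.
  + exact/cvg_at_left_filter/cF.
- by move=> x _; rewrite derive1E; case: (dF x).
Qed.

Lemma continuous_expRN s : continuous (fun t : R => expR (- (s * t))).
Proof.
move=> t; apply: continuous_comp; last exact: continuous_expR.
by apply: continuousN; apply: mulrl_continuous.
Qed.

Lemma lap_id d s : 0 < d -> 0 < s ->
  lap d id s = 1 - expR (- (s * d)) * (1 + s * d).
Proof.
move=> d0 s0; rewrite /lap.
pose F t : R := - (s ^- 2 * (expR (- (s * t)) * (s * t + 1))).
have -> : \int[mu]_(t in `[0, d]) (expR (- (s * t)) * id t) = F d - F 0.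
  apply: Rintegral_antiderivative => //.
    move=> t; apply: (@continuousM _ _ (fun t : R => expR (- (s * t))) id).
      exact: continuous_expRN.
    exact: cvg_id.
  move=> x; apply: is_derive_eq.
  by rewrite /GRing.scale/=; field; rewrite gt_eqF.
by rewrite /F mulr0 oppr0 expR0; field; rewrite gt_eqF.
Qed.

Lemma lap_sqr d s : 0 < d -> 0 < s -> lap d (fun t => t ^+ 2) s <= 2 / s.
Proof.
move=> d0 s0; rewrite /lap.
pose F t : R :=
  - (s ^- 3 * (expR (- (s * t)) * ((s * t) ^+ 2 + 2 * (s * t) + 2))).
have -> : \int[mu]_(t in `[0, d]) (expR (- (s * t)) * t ^+ 2) = F d - F 0.
  apply: Rintegral_antiderivative => //.
    move=> t.
    apply: (@continuousM _ _ (fun t : R => expR (- (s * t)))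
      (fun t : R => t ^+ 2)).
      exact: continuous_expRN.
    exact: exprn_continuous.
  move=> x; apply: is_derive_eq.
  by rewrite /GRing.scale/=; field; rewrite gt_eqF.
rewrite /F mulr0 oppr0 expR0.
have -> (E : R) : s ^+ 2 * (- (s ^- 3 * E) -
    - (s ^- 3 * (1 * (0 ^+ 2 + 2 * 0 + 2)))) = 2 / s - E / s.
  by field; rewrite gt_eqF.
rewrite gerBl divr_ge0 ?(ltW s0)// mulr_ge0 ?expR_ge0//.
by rewrite !addr_ge0 ?sqr_ge0 ?mulr_ge0 ?(ltW s0) ?(ltW d0).
Qed.

Lemma near_pinfty_div_le (A e : R) : 0 < e ->
  \forall s \near +oo, 0 < s /\ A / s <= e.
Proof.
move=> e0; apply: filterS2 (nbhs_pinfty_gt (num_real (0 : R)))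
  (nbhs_pinfty_ge (num_real (A / e))) => s s0 hs; split => //.
by rewrite ler_pdivrMr// mulrC -ler_pdivrMr.
Qed.

Lemma within_continuousM (A : set R) (f g : R -> R) :
  {within A, continuous f} -> {within A, continuous g} ->
  {within A, continuous (fun t => f t * g t)}.
Proof. by move=> cf cg x; apply: cvgM; [exact: cf|exact: cg]. Qed.

Lemma within_continuousN (A : set R) (f : R -> R) :
  {within A, continuous f} -> {within A, continuous (fun t => - f t)}.
Proof. by move=> cf x; apply: cvgN; exact: cf. Qed.

Lemma lap_integrable d psi s : {within `[0, d], continuous psi} ->
  mu.-integrable `[0, d] (EFin \o (fun t => expR (- (s * t)) * psi t)).
Proof.
move=> cpsi; apply: continuous_compact_integrable; first exact: segment_compact.
apply: within_continuousM => //.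
by apply: continuous_subspaceT; exact: continuous_expRN.
Qed.

Lemma lap_le d psi1 psi2 s : {within `[0, d], continuous psi1} ->
  {within `[0, d], continuous psi2} ->
  (forall t, 0 <= t <= d -> psi1 t <= psi2 t) ->
  lap d psi1 s <= lap d psi2 s.
Proof.
move=> c1 c2 le12; rewrite /lap ler_wpM2l ?sqr_ge0//.
apply: le_Rintegral => //; [exact: lap_integrable..|].
move=> t /=; rewrite in_itv/= => td.
by rewrite ler_wpM2l ?expR_ge0// le12.
Qed.

Lemma eq_lap d psi1 psi2 s : (forall t, 0 <= t <= d -> psi1 t = psi2 t) ->
  lap d psi1 s = lap d psi2 s.
Proof.
move=> e12; rewrite /lap; congr (_ * _); apply: eq_Rintegral => t.
by rewrite inE/= in_itv/= => td; rewrite e12.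
Qed.

Lemma lapD d psi1 psi2 s : {within `[0, d], continuous psi1} ->
  {within `[0, d], continuous psi2} ->
  lap d (fun t => psi1 t + psi2 t) s = lap d psi1 s + lap d psi2 s.
Proof.
move=> c1 c2; rewrite /lap -mulrDr -RintegralD//;
  [|exact: (@lap_integrable d psi1)|exact: (@lap_integrable d psi2)].
by congr (_ * _); apply: eq_Rintegral => t _; rewrite mulrDr.
Qed.

Lemma lapZ d psi k s : {within `[0, d], continuous psi} ->
  lap d (fun t => k * psi t) s = k * lap d psi s.
Proof.
move=> cpsi; rewrite /lap mulrCA -[k * _]RintegralZl//;
  last exact: (@lap_integrable d psi).
by congr (_ * _); apply: eq_Rintegral => t _; rewrite mulrCA.
Qed.

Lemma lapN d psi s : {within `[0, d], continuous psi} ->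
  lap d (fun t => - psi t) s = - lap d psi s.
Proof.
move=> cpsi; rewrite -mulN1r -lapZ//.
by apply: eq_lap => t _; rewrite mulN1r.
Qed.

Lemma lap_id_bounds d s : 0 < d -> 0 < s ->
  1 - 4 / d / s <= lap d id s <= 1.
Proof.
move=> d0 s0; rewrite lap_id//.
have sd0 : 0 < s * d by rewrite mulr_gt0.
have E0 : 0 < expR (- (s * d)) by exact: expR_gt0.
apply/andP; split; last first.
  by rewrite gerBl mulr_ge0 ?ltW// ltr_wpDl.
rewrite lerD2l lerN2 expRN -[4 / d / s]mulrA -invfM mulrC [d * s]mulrC.
rewrite ler_pdivrMr ?expR_gt0// mulrAC ler_pdivlMr//.
(* With [y = s * d], the goal [(1 + y) * y <= 4 * expR y] follows from the two bounds
   [1 + y ^+ 2 / 2 <= expR y] and [1 + y <= expR y]. *)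
have := @expR_ge1Dxn _ (s * d) 1 (ltW sd0).
have -> : 2`! = 2%N by [].
move=> h.
have h1 := expR_ge1Dx (s * d).
set y := s * d in sd0 h h1 *; set E := expR y in h h1 *.
nra.
Qed.

(** By monotonicity it suffices to transform [c * t - K * t ^+ 2]: the linear part gives [c] up to
    an error of order [1 / s], and the quadratic part is itself of order [1 / s]. *)
Lemma lap_quadratic_ge d psi c (K : R) s : 0 < d -> 0 < s -> 0 <= K ->
  {within `[0, d], continuous psi} ->
  (forall t, 0 <= t <= d -> c * t - K * t ^+ 2 <= psi t) ->
  c - (4 * `|c| / d + 2 * K) / s <= lap d psi s.
Proof.
move=> d0 s0 K0 cpsi hpsi.
have cid : {within `[0, d], continuous (@id R)}.
  by apply: continuous_subspaceT => x; exact: cvg_id.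
have csq : {within `[0, d], continuous (fun t : R => t ^+ 2)}.
  by apply: continuous_subspaceT; exact: exprn_continuous.
have cZ (f : R -> R) (k : R) : {within `[0, d], continuous f} ->
    {within `[0, d], continuous (fun t => k * f t)}.
  move=> cf; apply: within_continuousM => //.
  by apply: continuous_subspaceT => x; exact: cvg_cst.
have := @lap_le d (fun t => c * t + (- K) * t ^+ 2) psi s.
move=> /(_ _ cpsi) => /(_ (within_continuousD (cZ _ c cid) (cZ _ (- K) csq))).
rewrite lapD ?lapZ//; [|exact: cZ..].
move=> /(_ _)/(le_trans _); apply; last first.
  by move=> t /hpsi; rewrite mulNr.
have /andP[h1 h2] := lap_id_bounds d0 s0.
have h3 := lap_sqr d0 s0.
have {}h3 : K * lap d (fun t => t ^+ 2) s <= K * (2 / s) by rewrite ler_wpM2l.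
have h4 : c * (1 - lap d id s) <= `|c| * (4 / d / s).
  apply: (le_trans (ler_norm _)); rewrite normrM ler_wpM2l//.
  by rewrite ger0_norm; lra.
have -> : (4 * `|c| / d + 2 * K) / s = `|c| * (4 / d / s) + K * (2 / s).
  by field; rewrite !gt_eqF.
rewrite mulNr; lra.
Qed.

Lemma lap_ge_quadratic d psi c (K : R) : 0 < d -> 0 <= K ->
  {within `[0, d], continuous psi} ->
  (forall t, 0 <= t <= d -> c * t - K * t ^+ 2 <= psi t) -> lap_ge d psi c.
Proof.
move=> d0 K0 cpsi hpsi e e0.
apply: filterS (near_pinfty_div_le (4 * `|c| / d + 2 * K) e0) => s [s0 hs].
by apply: le_trans (lap_quadratic_ge d0 s0 K0 cpsi hpsi); rewrite lerB.
Qed.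

(** The quadratic estimate for [- psi] bounds [lap d psi s] from above by [c] plus a term of order
    [1 / s]. *)
Lemma lap_ge_le d psi c c' (K : R) : 0 < d -> 0 <= K ->
  {within `[0, d], continuous psi} ->
  (forall t, 0 <= t <= d -> psi t <= c * t + K * t ^+ 2) ->
  lap_ge d psi c' -> c' <= c.
Proof.
move=> d0 K0 cpsi hpsi hge; apply/ler_addgt0Pr => e e0.
have e20 : 0 < e / 2 by rewrite divr_gt0.
have [s [h1 [s0 hs]]] := filter_ex (filterI (hge _ e20)
  (near_pinfty_div_le (4 * `|- c| / d + 2 * K) e20)).
have : - c - (4 * `|- c| / d + 2 * K) / s <= lap d (fun t => - psi t) s.
  apply: lap_quadratic_ge => //; first exact: within_continuousN.
  by move=> t td; have := hpsi t td; lra.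
by rewrite lapN//; lra.
Qed.

Lemma lap_geD d psi1 psi2 c1 c2 : {within `[0, d], continuous psi1} ->
  {within `[0, d], continuous psi2} -> lap_ge d psi1 c1 -> lap_ge d psi2 c2 ->
  lap_ge d (fun t => psi1 t + psi2 t) (c1 + c2).
Proof.
move=> cp1 cp2 h1 h2 e e0; have e20 : 0 < e / 2 by rewrite divr_gt0.
apply: filterS2 (h1 _ e20) (h2 _ e20) => s {}h1 {}h2.
by rewrite lapD//; lra.
Qed.

Lemma eq_lap_ge d psi1 psi2 c : (forall t, 0 <= t <= d -> psi1 t = psi2 t) ->
  lap_ge d psi1 c -> lap_ge d psi2 c.
Proof.
move=> e12 h e /h; apply: filterS => s.
by rewrite (eq_lap _ e12).
Qed.

(** On [[d1, d2]] the integrand is at most a constant times [expR (- (s * d1))], which beats the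
    factor [s ^+ 2]. *)
Lemma lap_tail d1 d2 psi : 0 < d1 -> d1 < d2 ->
  {within `[0, d2], continuous psi} ->
  exists A, forall s, 0 < s -> `|lap d2 psi s - lap d1 psi s| <= A / s.
Proof.
move=> d10 d12 cpsi.
have d20 := lt_trans d10 d12.
have cnpsi : {within `[0, d2], continuous (fun t => `|psi t|)}.
  by move=> x; apply: cvg_norm; exact: cpsi.
have [m _ hm] := @EVT_max R (fun t => `|psi t|) 0 d2 (ltW d20) cnpsi.
set B := `|psi m| in hm.
exists (6 * B * (d2 - d1) / d1 ^+ 3) => s s0.
have iI := lap_integrable s cpsi.
rewrite /lap -mulrBr Rintegral_itvB//=; [|by rewrite bnd_simp ltW..].
rewrite normrM ger0_norm ?sqr_ge0//.
have iI2 : mu.-integrable `]d1, d2]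
    (EFin \o (fun t => expR (- (s * t)) * psi t)).
  apply: integrableS iI => //; apply: subset_itvr.
  by rewrite bnd_simp ltW.
rewrite Rintegral_itv_obnd_cbnd//.
have sub12 : `[d1, d2] `<=` `[0, d2].
  by apply: subset_itvr; rewrite bnd_simp ltW.
have cI2 : {within `[d1, d2], continuous (fun t => expR (- (s * t)) * psi t)}.
  apply: within_continuousM.
    by apply: continuous_subspaceT; exact: continuous_expRN.
  exact: continuous_subspaceW cpsi.
have {}iI2 := continuous_compact_integrable (@segment_compact _ d1 d2) cI2.
have := @le_normr_Rintegral _ _ _ mu `[d1, d2] _ (measurable_itv _) iI2.
have : \int[mu]_(t in `[d1, d2]) `|expR (- (s * t)) * psi t| <=
    \int[mu]_(t in `[d1, d2]) (expR (- (s * d1)) * B).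
  apply: le_Rintegral => //.
  - apply: continuous_compact_integrable; first exact: segment_compact.
    by move=> x; apply: cvg_norm; exact: cI2.
  - apply: continuous_compact_integrable; first exact: segment_compact.
    by apply: continuous_subspaceT => x; exact: cvg_cst.
  - move=> t /=; rewrite in_itv/= => /andP[t1 t2].
    rewrite normrM ger0_norm ?expR_ge0// ler_pM ?expR_ge0//.
      by rewrite ler_expR lerN2 ler_pM2l.
    by apply: hm; rewrite in_itv/= t2 andbT (le_trans _ t1)// ltW.
have -> : \int[mu]_(t in `[d1, d2]) (expR (- (s * d1)) * B) =
    expR (- (s * d1)) * B * (d2 - d1).
  by rewrite Rintegral_cst//= lebesgue_measure_itv/= lte_fin d12.
move=> h1 h2.
have {h1 h2}h := le_trans h2 h1.
apply: (le_trans (ler_wpM2l (sqr_ge0 s) h)).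
have B0 : 0 <= B by exact: normr_ge0.
have sd0 : 0 < s * d1 by rewrite mulr_gt0.
(* The cubic term of the exponential absorbs [s ^+ 2] and leaves a factor [1 / s]. *)
have hE := @expR_ge1Dxn _ (s * d1) 2 (ltW sd0).
rewrite expRN; set E := expR (s * d1) in hE *.
have E0 : 0 < E by exact: expR_gt0.
have -> : s ^+ 2 * (E^-1 * B * (d2 - d1)) =
   (6 * B * (d2 - d1) / d1 ^+ 3 / s) * ((s * d1) ^+ 3 / 6 / E).
  by field; rewrite !gt_eqF.
rewrite ler_piMr//.
  rewrite !mulr_ge0 ?invr_ge0 ?exprn_ge0 ?(ltW s0) ?(ltW d10)//.
  by rewrite subr_ge0 ltW.
rewrite ler_pdivrMr// mul1r.
have e6 : 3`!%:R = 6 :> R by [].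
rewrite e6 in hE; lra.
Qed.

(** Changing the radius alters the transform by [O(1 / s)], so the lower bound does not depend on
    the radius. *)
Lemma lap_ge_delta d1 d2 psi c : 0 < d1 -> 0 < d2 ->
  {within `[0, d1], continuous psi} -> {within `[0, d2], continuous psi} ->
  lap_ge d1 psi c -> lap_ge d2 psi c.
Proof.
move=> d10 d20 c1 c2 h e e0; have e20 : 0 < e / 2 by rewrite divr_gt0.
have [A hA] : exists A, forall s, 0 < s ->
    `|lap d2 psi s - lap d1 psi s| <= A / s.
  have [d12|d21|->] := ltgtP d1 d2.
  - exact: lap_tail.
  - have [A hA] := lap_tail d20 d21 c1.
    by exists A => s /hA; rewrite distrC.
  - by exists 0 => s _; rewrite subrr normr0 mul0r.
apply: filterS2 (h _ e20) (near_pinfty_div_le A e20) => s h1 [/hA].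
by rewrite ler_norml => /andP[h2 h3] h4; lra.
Qed.

End LaplaceTransform.

(** * Laplace derivates, major and minor functions in epsilon form *)

Section Derivates.
Variable R : realType.
Implicit Types (F U V f g : R -> R) (a b c d x : R).

(** The retraction of the line onto [[a, b]]; composing with it extends a function continuous on
    [[a, b]] to one continuous everywhere. *)
Definition clamp a b x := Num.max a (Num.min b x).

Lemma clamp_id a b x : a <= x <= b -> clamp a b x = x.
Proof. by case/andP=> ax xb; rewrite /clamp (min_idPr xb) (max_idPr ax). Qed.

Lemma clamp_itv a b x : a <= b -> a <= clamp a b x <= b.
Proof. by move=> ab; rewrite /clamp le_max lexx ge_max ab ge_min lexx. Qed.

Lemma continuous_clamp a b : continuous (clamp a b).
Proof.
move=> x; apply: (@continuous_max R R (cst a) (Num.min b)).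
  exact: cvg_cst.
by apply: (@continuous_min R R (cst b) id); [exact: cvg_cst|exact: cvg_id].
Qed.

Lemma continuous_comp_clamp a b F : a <= b ->
  {within `[a, b], continuous F} -> continuous (F \o clamp a b).
Proof.
move=> ab /subspace_continuousP cF x.
have xab : [set` `[a, b]] (clamp a b x) by rewrite /= in_itv/= clamp_itv.
apply: cvg_comp (cF _ xab) => P hP.
have h : nbhs x
    (fun y => [set` `[a, b]] (clamp a b y) -> P (clamp a b y)).
  exact: (@continuous_clamp a b x _ hP).
change (nbhs x (fun y => P (clamp a b y))).
apply: filterS h => y; apply.
by rewrite /= in_itv/=; exact: clamp_itv.
Qed.

Definition rinc F x (t : R) := F (x + t) - F x.
(** This orientation absorbs the minus sign of [lap_left], so that left and right derivates are
    treated alike. *)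
Definition linc F x (t : R) := F x - F (x - t).

Lemma continuous_rinc F x : continuous F -> continuous (rinc F x).
Proof.
move=> cF t; apply: continuousB; last exact: cvg_cst.
apply: (@continuous_comp _ _ _ (fun t : R => x + t) F); last exact: cF.
by apply: cvgD; [exact: cvg_cst|exact: cvg_id].
Qed.

Lemma continuous_linc F x : continuous F -> continuous (linc F x).
Proof.
move=> cF t; apply: continuousB; first exact: cvg_cst.
apply: (@continuous_comp _ _ _ (fun t : R => x - t) F); last exact: cF.
by apply: cvgB; [exact: cvg_cst|exact: cvg_id].
Qed.

Lemma within_continuous_rinc a b d F x : {within `[a, b], continuous F} ->
  a <= x -> 0 < d -> d <= b - x -> {within `[0, d], continuous (rinc F x)}.
Proof.
move=> cF ax d0 db.
have ab : a <= b by lra.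
apply: (@subspace_eq_continuous _ _ _ (rinc (F \o clamp a b) x)).
  move=> t; rewrite inE/= in_itv/= => /andP[t0 td].
  by rewrite /rinc/= !clamp_id//; lra.
apply: continuous_subspaceT; apply: continuous_rinc.
exact: continuous_comp_clamp.
Qed.

Lemma within_continuous_linc a b d F x : {within `[a, b], continuous F} ->
  x <= b -> 0 < d -> d <= x - a -> {within `[0, d], continuous (linc F x)}.
Proof.
move=> cF ax d0 db.
have ab : a <= b by lra.
apply: (@subspace_eq_continuous _ _ _ (linc (F \o clamp a b) x)).
  move=> t; rewrite inE/= in_itv/= => /andP[t0 td].
  by rewrite /linc/= !clamp_id//; lra.
apply: continuous_subspaceT; apply: continuous_linc.
exact: continuous_comp_clamp.
Qed.

Lemma liminf_pinfty_ge (g : R -> R) c : (c%:E <= liminf_pinfty g)%E <->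
  forall e, 0 < e -> \forall s \near +oo, c - e <= g s.
Proof.
rewrite /liminf_pinfty limf_einfE; split=> [h e e0|h].
  have /ereal_sup_gt[_ [A FA <-] h1] :
      ((c - e)%:E < ereal_sup [set ereal_inf ((fun s => (g s)%:E) @` V)
        | V in pinfty_nbhs R])%E.
    by apply: lt_le_trans h; rewrite lte_fin gtrBl.
  apply: filterS FA => s As; rewrite -lee_fin; apply: (le_trans (ltW h1)).
  by apply: ereal_inf_lbound; exists s.
apply/lee_subgt0Pr => e e0; apply: le_trans (ereal_sup_ubound _); last first.
  by exists [set s | c - e <= g s]; [exact: h|reflexivity].
by apply: le_ereal_inf_tmp => _ [s /= hs <-]; rewrite -EFinB lee_fin.
Qed.

Lemma limsup_pinftyN (g : R -> R) :
  limsup_pinfty (fun s => - g s) = (- liminf_pinfty g)%E.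
Proof.
rewrite /limsup_pinfty /liminf_pinfty -limf_esupN; congr limf_esup.
Qed.

Lemma lap_rightE F x d s : lap_right F x d s = lap d (rinc F x) s.
Proof. by []. Qed.

Lemma lap_leftE F x d s : {within `[0, d], continuous (linc F x)} ->
  lap_left F x d s = lap d (linc F x) s.
Proof.
move=> cl; rewrite -[RHS]opprK -lapN// /lap_left /lap mulNr.
by congr (- (_ * _)); apply: eq_Rintegral => t _; rewrite opprB.
Qed.

(** At an endpoint one of the two conditions is vacuous, as no [d > 0] satisfies [d <= 0]; this
    merges the three cases of [lowerLD]. Quantifying over all radii makes restriction to
    subintervals immediate. *)
Definition lower_ge a b F x c :=
  (forall d, 0 < d -> d <= b - x -> lap_ge d (rinc F x) c) /\
  (forall d, 0 < d -> d <= x - a -> lap_ge d (linc F x) c).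

Lemma liminf_lap_rightP a b d F x c : {within `[a, b], continuous F} ->
  a <= x -> 0 < d -> d <= b - x ->
  (c%:E <= liminf_pinfty (lap_right F x d))%E <->
  (forall d, 0 < d -> d <= b - x -> lap_ge d (rinc F x) c).
Proof.
move=> cF ax d0 db; split.
  move/liminf_pinfty_ge => h d' d'0 d'b.
  by apply: (lap_ge_delta d0 d'0) h; exact: within_continuous_rinc cF ax _ _.
by move=> h; apply/liminf_pinfty_ge; exact: h d0 db.
Qed.

Lemma liminf_lap_leftP a b d F x c : {within `[a, b], continuous F} ->
  x <= b -> 0 < d -> d <= x - a ->
  (c%:E <= liminf_pinfty (lap_left F x d))%E <->
  (forall d, 0 < d -> d <= x - a -> lap_ge d (linc F x) c).
Proof.
move=> cF xb d0 da.
have -> : lap_left F x d = lap d (linc F x).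
  by apply/funext => s; apply: lap_leftE;
    exact: within_continuous_linc cF xb _ _.
split.
  move/liminf_pinfty_ge => h d' d'0 d'a.
  by apply: (lap_ge_delta d0 d'0) h; exact: within_continuous_linc cF xb _ _.
by move=> h; apply/liminf_pinfty_ge; exact: h d0 da.
Qed.

Lemma lowerLD_geP a b F x c : a < b -> {within `[a, b], continuous F} ->
  a <= x <= b -> (c%:E <= lowerLD a b F x)%E <-> lower_ge a b F x c.
Proof.
move=> ab cF /andP[ax xb]; rewrite /lowerLD /lower_ge.
have ba0 : 0 < b - a by rewrite subr_gt0.
have [->|xa] := eqVneq x a.
  rewrite (liminf_lap_rightP c cF)//; split=> [h|[]//].
  by split=> // d d0; rewrite subrr leNgt d0.
have [->|xb'] := eqVneq x b.
  rewrite (liminf_lap_leftP c cF)//; split=> [h|[]//].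
  by split=> // d d0; rewrite subrr leNgt d0.
have {}xa : a < x by rewrite lt_neqAle eq_sym xa.
have {}xb' : x < b by rewrite lt_neqAle xb'.
set m := Order.min (x - a) (b - x).
have m0 : 0 < m by rewrite lt_min !subr_gt0 xa.
have ma : m <= x - a by rewrite ge_min lexx.
have mb : m <= b - x by rewrite ge_min lexx orbT.
rewrite le_min; split.
  by move=> /andP[/(liminf_lap_rightP c cF ax m0 mb) h1
    /(liminf_lap_leftP c cF xb m0 ma) h2].
by move=> [h1 h2]; apply/andP; split;
  [exact/(liminf_lap_rightP c cF ax m0 mb)|
   exact/(liminf_lap_leftP c cF xb m0 ma)].
Qed.

Lemma upperLDN a b F x : a < b -> {within `[a, b], continuous F} ->
  a <= x <= b -> upperLD a b (fun y => - F y) x = (- lowerLD a b F x)%E.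
Proof.
move=> ab cF /andP[ax xb].
have hr d : 0 < d -> d <= b - x ->
    limsup_pinfty (lap_right (fun y => - F y) x d) =
    (- liminf_pinfty (lap_right F x d))%E.
  move=> d0 db; rewrite -limsup_pinftyN; congr limsup_pinfty.
  apply/funext => s; rewrite !lap_rightE -lapN; last first.
    exact: within_continuous_rinc cF ax _ _.
  by apply: eq_lap => t _; rewrite /rinc opprB addrC opprK.
have hl d : 0 < d -> d <= x - a ->
    limsup_pinfty (lap_left (fun y => - F y) x d) =
    (- liminf_pinfty (lap_left F x d))%E.
  move=> d0 db; rewrite -limsup_pinftyN; congr limsup_pinfty.
  have cl : {within `[0, d], continuous (linc F x)}.
    exact: within_continuous_linc cF xb _ _.
  have e : linc (fun y => - F y) x = (fun t => - linc F x t).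
    by apply/funext => t; rewrite /linc opprB addrC opprK.
  apply/funext => s; rewrite !lap_leftE// e ?lapN//.
  exact: within_continuousN.
rewrite /upperLD /lowerLD; have [xa|xa] := eqVneq x a.
  by rewrite hr ?xa// subr_gt0.
have [xb'|xb'] := eqVneq x b.
  by rewrite hl ?xb'// subr_gt0.
have {}xa : a < x by rewrite lt_neqAle eq_sym xa.
have {}xb' : x < b by rewrite lt_neqAle xb'.
set m := Order.min (x - a) (b - x).
have m0 : 0 < m by rewrite lt_min !subr_gt0 xa.
have ma : m <= x - a by rewrite ge_min lexx.
have mb : m <= b - x by rewrite ge_min lexx orbT.
by rewrite hr// hl// oppe_min.
Qed.

Lemma majorP a b f U : a < b -> major a b f U <->
  {within `[a, b], continuous U} /\
  forall x, a <= x <= b -> lower_ge a b U x (f x).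
Proof.
move=> ab; split=> -[cU h]; split=> // x.
  move=> xab; have xI : x \in `[a, b] by rewrite in_itv.
  have [h1 _] := h x xI.
  exact/lowerLD_geP.
rewrite in_itv/= => xab; have h1 := h x xab.
have h2 : ((f x)%:E <= lowerLD a b U x)%E by exact/lowerLD_geP.
by split=> //; apply: lt_le_trans h2; rewrite ltNyr.
Qed.

(** Negation exchanges upper and lower derivates, so everything proved for major functions transfers
    to minor functions. *)
Lemma minorE a b f V : a < b ->
  minor a b f V <-> major a b (fun x => - f x) (fun x => - V x).
Proof.
move=> ab; have VE : (fun x => - - V x) = V by apply/funext => x; rewrite opprK.
have h x : {within `[a, b], continuous (fun x => - V x)} -> x \in `[a, b] ->
    upperLD a b V x = (- lowerLD a b (fun x => - V x)%R x)%E.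
  by rewrite in_itv/= => cV xab; rewrite -[in LHS]VE upperLDN.
have cVE : {within `[a, b], continuous V} <->
    {within `[a, b], continuous (fun x => - V x)}.
  split=> [|/within_continuousN]; first exact: within_continuousN.
  by rewrite VE.
split=> -[cV hV].
  split=> [|x xab]; first exact/cVE.
  have [h1 h2] := hV x xab.
  rewrite h// in h1 h2; [|exact/cVE..].
  by split; [rewrite EFinN leeNl|rewrite lteNl in h2].
split=> [|x xab]; first exact/cVE.
have [h1 h2] := hV x xab.
rewrite h//; split; [by rewrite leeNl|by rewrite lteNl].
Qed.

Lemma majorD a b f g U W : a < b -> major a b f U -> major a b g W ->
  major a b (fun x => f x + g x) (fun x => U x + W x).
Proof.
move=> ab /(majorP _ _ ab)[cU hU] /(majorP _ _ ab)[cW hW].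
apply/(majorP _ _ ab); split; first exact: (within_continuousD cU cW).
move=> x xab; have [hU1 hU2] := hU x xab; have [hW1 hW2] := hW x xab.
have /andP[ax xb] := xab; split=> d d0 dx.
  apply: (@eq_lap_ge _ _ (fun t => rinc U x t + rinc W x t)).
    by move=> t _; rewrite /rinc; ring.
  by apply: lap_geD; [exact: within_continuous_rinc cU ax _ _|
    exact: within_continuous_rinc cW ax _ _|exact: hU1|exact: hW1].
apply: (@eq_lap_ge _ _ (fun t => linc U x t + linc W x t)).
  by move=> t _; rewrite /linc; ring.
by apply: lap_geD; [exact: within_continuous_linc cU xb _ _|
  exact: within_continuous_linc cW xb _ _|exact: hU2|exact: hW2].
Qed.

Lemma major_sub a b c d f U : a <= c -> c < d -> d <= b ->
  major a b f U -> major c d f U.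
Proof.
move=> ac cd db; have ab : a < b by lra.
move=> /(majorP _ _ ab)[cU hU]; apply/(majorP _ _ cd); split.
  apply: continuous_subspaceW cU; apply: subset_itv; rewrite bnd_simp//.
move=> x /andP[cx xd]; have [|h1 h2] := hU x; first by lra.
by split=> e e0 ex; [apply: h1|apply: h2] => //; lra.
Qed.

End Derivates.

(** * From derivate bounds to growth of the function, pointwise and by Baire category *)

Section Growth.
Variable R : realType.
Implicit Types (F U V W f g : R -> R) (a b c d x : R).

(* The maximum of [F x - c * x] over [a, b] is not attained at [b], since [c]
   exceeds the slope of the chord of [F]. *)
Lemma exists_right_slope_le a b c F : a < b -> {within `[a, b], continuous F} ->
  F b - F a < c * (b - a) ->
  exists2 x, a <= x < b & forall y, x <= y <= b -> F y - F x <= c * (y - x).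
Proof.
move=> ab cF Fab.
have cG : {within `[a, b], continuous (fun x => F x + - (c * x))}.
  apply: (within_continuousD cF); apply: continuous_subspaceT => x.
  by apply: continuousN; exact: mulrl_continuous.
have [x xab hx] := EVT_max (ltW ab) cG.
move: xab; rewrite in_itv/= => /andP[ax xb].
have xb' : x < b.
  rewrite lt_neqAle xb andbT; apply/eqP => xE.
  have := hx a; rewrite in_itv/= lexx ltW// xE => /(_ isT); lra.
exists x; first by rewrite ax.
move=> y /andP[xy yb].
have := hx y; rewrite in_itv/= yb (le_trans ax xy) => /(_ isT); lra.
Qed.

(** If the chord had slope below [c], some point would have all its increments to the right bounded
    with a slope [c'] smaller than [c], forcing its right Laplace derivate below [c]. *)
Lemma increment_ge a b c F : a < b -> {within `[a, b], continuous F} ->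
  (forall x, a <= x < b ->
     exists d, [/\ 0 < d, d <= b - x & lap_ge d (rinc F x) c]) ->
  c * (b - a) <= F b - F a.
Proof.
move=> ab cF h; rewrite leNgt; apply/negP => lt_slope.
have ba0 : 0 < b - a by rewrite subr_gt0.
have bane0 : b - a != 0 by rewrite gt_eqF.
(* The midpoint between [c] and the chord slope lies strictly between them. *)
pose c' := (c + (F b - F a) / (b - a)) / 2.
have c'E : c' * (b - a) = (c * (b - a) + (F b - F a)) / 2.
  by rewrite /c'; field.
have [|x /andP[ax xb] hx] := @exists_right_slope_le a b c' F ab cF.
  by rewrite c'E; lra.
have [|d [d0 db hd]] := h x; first by rewrite ax.
have cc' : c <= c'.
  apply: (@lap_ge_le _ d (rinc F x) c' c 0) => //.
    exact: within_continuous_rinc cF ax d0 db.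
  move=> t /andP[t0 td]; rewrite mul0r addr0 /rinc.
  have := hx (x + t); rewrite addrAC subrr add0r; apply.
  by apply/andP; split; lra.
have : c * (b - a) <= c' * (b - a) by rewrite ler_pM2r.
by rewrite c'E; lra.
Qed.

Lemma lap_ge_trans d (psi : R -> R) c c' :
  c' <= c -> lap_ge d psi c -> lap_ge d psi c'.
Proof.
move=> cc h e e0; apply: filterS (h e e0) => s; apply: le_trans.
by rewrite lerB.
Qed.

Lemma major_ge0_nondecreasing a b f W x y : major a b f W ->
  (forall z, a <= z <= b -> 0 <= f z) -> a <= x -> x <= y -> y <= b ->
  W x <= W y.
Proof.
move=> mW f0 ax; rewrite le_eqVlt => /predU1P[->//|xy] yb.
have [cW hW] := (majorP _ _ xy).1 (major_sub ax xy yb mW).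
rewrite -subr_ge0 -(mul0r (y - x)); apply: increment_ge => // z /andP[xz zy].
have zy0 : 0 < y - z by rewrite subr_gt0.
exists (y - z); split=> //.
have [|h _] := hW z; first by rewrite xz ltW.
by apply: lap_ge_trans (h _ zy0 (lexx _)); apply: f0; apply/andP; split; lra.
Qed.

(** Dominated convergence; this is what makes the sets of the Baire argument open. *)
Lemma continuous_lap_rinc W s : continuous W ->
  continuous (fun x => lap 1 (rinc W x) s).
Proof.
move=> cW x0; apply: (@continuousM _ _ (cst (s ^+ 2))
  (fun x => \int[@lebesgue_measure R]_(t in `[0, 1])
    (expR (- (s * t)) * rinc W x t))).
  exact: cvg_cst.
(* This interval contains [x] and [x + t] whenever [x] is within 1 of [x0] and [t] lies in [[0, 1]];
   twice the maximum there dominates the increments. *)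
have cnW : {within `[x0 - 1, x0 + 2], continuous (fun x => `|W x|)}.
  by apply: continuous_subspaceT => x; apply: cvg_norm; exact: cW.
have x012 : x0 - 1 <= x0 + 2 by lra.
have [m _ hm] := EVT_max x012 cnW.
have cE : continuous (fun t : R => expR (- (s * t))) by exact: continuous_expRN.
have cstE k : {within `[0, 1], continuous (fun t : R => expR (- (s * t)) * k)}.
  apply: within_continuousM; first exact: continuous_subspaceT.
  by apply: continuous_subspaceT => t; exact: cvg_cst.
apply: (@continuity_under_integral R _ _ (@lebesgue_measure R)
  (fun x t => expR (- (s * t)) * rinc W x t) `[0, 1] (measurable_itv _)
  (x0 - 1) (x0 + 1) _ _ (fun t => expR (- (s * t)) * (`|W m| + `|W m|)) _ _).
- move=> x _; apply: lap_integrable; apply: continuous_subspaceT.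
  exact: continuous_rinc.
- apply: aeW => t _ x _.
  apply: (@continuousM _ _ (cst (expR (- (s * t)))) (rinc W ^~ t)).
    exact: cvg_cst.
  apply: continuousB; last exact: cW.
  apply: (@continuous_comp _ _ _ (fun y : R => y + t) W); last exact: cW.
  by apply: cvgD; [exact: cvg_id|exact: cvg_cst].
- by apply: continuous_compact_integrable; [exact: segment_compact|exact: cstE].
- move=> x /=; rewrite in_itv/= => /andP[x1 x2]; apply: aeW => t /=.
  rewrite in_itv/= => /andP[t0 t1].
  rewrite normrM (ger0_norm (expR_ge0 _)) ler_wpM2l ?expR_ge0//.
  by apply: (le_trans (ler_normB _ _)); apply: lerD; apply: hm;
    rewrite in_itv/=; apply/andP; split; lra.
- by rewrite inE/= in_itv/=; apply/andP; split; lra.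
Qed.

(* The sets where [lap 1 (rinc W x) s] stays above [- n] for all [s >= n] are
   closed and cover [`]p, q[], so by Baire one of them contains an interval. *)
Lemma exists_subinterval_increment_ge W p q : continuous W -> p < q ->
  (forall x, p < x < q -> exists M, lap_ge 1 (rinc W x) M) ->
  exists p' q' M, [/\ p <= p', p' < q', q' <= q &
    forall x y, p' <= x -> x <= y -> y <= q' -> M * (y - x) <= W y - W x].
Proof.
move=> cW pq hW; apply: contrapT => hN.
(* The points outside [[p, q]] are included so that the sets are open and dense in the whole
   line. *)
pose O (n : nat) : set R := [set x | x < p \/ q < x \/
  exists2 s, n%:R <= s & lap 1 (rinc W x) s < - n%:R].
have O_open n : open (O n).
  have -> : O n = [set x | x < p] `|` [set x | q < x] `|`
      \bigcup_(s in [set s | n%:R <= s]) [set x | lap 1 (rinc W x) s < - n%:R].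
    apply/seteqP; split=> x /=.
      by move=> [|[|[s ns h]]]; [left; left|left; right|right; exists s].
    by move=> [[|]|[s ns h]]; [left|right; left|right; right; exists s].
  apply: openU; first by apply: openU; [exact: open_lt|exact: open_gt].
  apply: bigcup_open => s _.
  have := @open_comp _ _ (fun x => lap 1 (rinc W x) s) [set y | y < - n%:R].
  apply; last exact: open_lt.
  by move=> x _; exact: continuous_lap_rinc.
(* An open set missing [O n] contains a closed interval on which the bound [- n] holds for all
   [s >= n]; [increment_ge] turns it into the subinterval that [hN] denies. *)
have O_dense n : dense (O n).
  move=> A [z Az] oA; apply: contrapT => AO.
  have nO x : A x -> [/\ p <= x, x <= q &
      forall s, n%:R <= s -> - n%:R <= lap 1 (rinc W x) s].
    move=> Ax; have nOx : ~ O n x by move=> Ox; apply: AO; exists x.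
    split; [| |move=> s ns]; rewrite leNgt; apply/negP => h; apply: nOx;
      [by left|by right; left|by right; right; exists s].
  have [r /= r0 hr] := (nbhs_ballP _ _).1 (open_nbhs_nbhs (conj oA Az)).
  have inA x : z - r / 2 <= x <= z + r / 2 -> A x.
    move=> /andP[x1 x2]; apply: hr; rewrite /ball/= ltr_norml.
    by apply/andP; split; lra.
  apply: hN; exists (z - r / 2), (z + r / 2), (- n%:R); split.
  - by have [] := nO (z - r / 2) (inA _ _); first by apply/andP; split; lra.
  - by lra.
  - by have [] := nO (z + r / 2) (inA _ _); first by apply/andP; split; lra.
  move=> x y zx; rewrite le_eqVlt => /predU1P[->|xy] yz.
    by rewrite !subrr mulr0.
  apply: increment_ge => //; first exact: continuous_subspaceT.
  move=> t /andP[xt ty]; have yt0 : 0 < y - t by rewrite subr_gt0.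
  exists (y - t); split=> //.
  have cr d : {within `[0, d], continuous (rinc W t)}.
    by apply: continuous_subspaceT; exact: continuous_rinc.
  apply: (@lap_ge_delta _ 1) => //.
  move=> e e0; apply: filterS (nbhs_pinfty_ge (num_real n%:R)) => s ns.
  have [|_ _ h] := nO t (inA _ _); first by apply/andP; split; lra.
  by apply: (le_trans _ (h s ns)); rewrite gerBl ltW.
have := @Baire R R O (fun n => conj (O_open n) (O_dense n)).
move=> /(_ [set` `]p, q[]) [||x []].
- by exists ((p + q) / 2); rewrite /= in_itv/= midf_lt ?midf_lt//; exact/andP.
- exact: interval_open.
rewrite /= in_itv/= => pxq Ox.
have [M hM] := hW x pxq.
have [s0 [_ hs0]] := hM 1 ltr01.
(* Every [s >= n] then exceeds [s0], where the transform is at least [M - 1 > - n], against [x]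
   lying in [O n]. *)
have := Ox (Num.bound (`|s0| + `|M| + 1)) I.
set n := Num.bound _.
have hn : `|s0| + `|M| + 1 < n%:R.
  by apply: archi_boundP; rewrite !addr_ge0.
have := ler_norm s0; have := ler_norm (- M); rewrite normrN => h1 h2.
have h3 := normr_ge0 M; have h4 := normr_ge0 s0.
case/andP: pxq => px xq [|[|[s ns hs]]]; [lra|lra|].
have h5 : M - 1 <= lap 1 (rinc W x) s by apply: hs0; rewrite /=; lra.
lra.
Qed.

End Growth.

(** * Laplace integrals of smooth functions and limits in the Alexiewicz norm *)

Section Integral.
Variable R : realType.
Implicit Types (F U V W f g : R -> R) (a b c d x y : R).

(* A quadratic remainder gives [F] the Laplace derivative [f] at every point, so
   [F] is both a major and a minor function of [f]. *)
Definition quadratic_primitive F f := continuous F /\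
  exists2 K, 0 <= K & forall x t, `|F (x + t) - F x - f x * t| <= K * t ^+ 2.

Lemma quadratic_primitiveN F f : quadratic_primitive F f ->
  quadratic_primitive (fun x => - F x) (fun x => - f x).
Proof.
move=> [cF [K K0 hK]]; split; first by move=> x; apply: continuousN; exact: cF.
exists K => // x t; rewrite -normrN; apply: le_trans (hK x t).
by rewrite le_eqVlt; apply/orP; left; apply/eqP; congr Num.norm; ring.
Qed.

Lemma quadratic_primitiveD F G f g : quadratic_primitive F f ->
  quadratic_primitive G g ->
  quadratic_primitive (fun x => F x + G x) (fun x => f x + g x).
Proof.
move=> [cF [K K0 hK]] [cG [L L0 hL]]; split.
  by move=> x; apply: continuousD; [exact: cF|exact: cG].
exists (K + L) => [|x t]; first exact: addr_ge0.
rewrite [leRHS]mulrDl; apply: le_trans (lerD (hK x t) (hL x t)).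
apply: (le_trans _ (ler_normD _ _)).
by rewrite le_eqVlt; apply/orP; left; apply/eqP; congr Num.norm; ring.
Qed.

Lemma quadratic_primitive_major a b F f : a < b ->
  quadratic_primitive F f -> major a b f F.
Proof.
move=> ab [cF [K K0 hK]]; apply/(majorP _ _ ab); split.
  exact: continuous_subspaceT.
move=> x xab; split=> d d0 _; apply: (@lap_ge_quadratic _ d _ _ K) => //.
- by apply: continuous_subspaceT; exact: continuous_rinc.
- move=> t _; have := hK x t; rewrite ler_norml /rinc => /andP[h1 h2]; lra.
- by apply: continuous_subspaceT; exact: continuous_linc.
- move=> t _; have := hK x (- t); rewrite ler_norml /linc sqrrN mulrN.
  by move=> /andP[h1 h2]; lra.
Qed.

Lemma quadratic_primitive_minor a b F f : a < b ->
  quadratic_primitive F f -> minor a b f F.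
Proof.
move=> ab qF; apply/(minorE _ _ ab); apply: quadratic_primitive_major => //.
exact: quadratic_primitiveN.
Qed.

(** [U - V] is a major function of [f - f = 0], hence nondecreasing. *)
Lemma minor_le_major a b f U V x y : major a b f U -> minor a b f V ->
  a <= x -> x <= y -> y <= b -> V y - V x <= U y - U x.
Proof.
move=> mU mV ax; rewrite le_eqVlt => /predU1P[->|xy] yb.
  by rewrite !subrr.
have ab : a < b by lra.
have mUV := majorD ab mU ((minorE f V ab).1 mV).
have h : U x + - V x <= U y + - V y.
  by apply: (major_ge0_nondecreasing mUV) => //;
    [move=> z _; rewrite subrr|exact: ltW].
lra.
Qed.

Lemma lap_inf_primitive a b F f : a < b -> quadratic_primitive F f ->
  lap_inf a b f = (F b - F a)%:E.
Proof.
move=> ab qF; apply/eqP; rewrite eq_le; apply/andP; split.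
  apply: ereal_inf_lbound; exists F => //.
  exact: quadratic_primitive_major.
apply: le_ereal_inf_tmp => _ [U mU <-]; rewrite lee_fin.
apply: (minor_le_major mU) => //; last exact: ltW.
exact: quadratic_primitive_minor.
Qed.

Lemma lap_sup_primitive a b F f : a < b -> quadratic_primitive F f ->
  lap_sup a b f = (F b - F a)%:E.
Proof.
move=> ab qF; apply/eqP; rewrite eq_le; apply/andP; split.
  apply: ge_ereal_sup => _ [V mV <-]; rewrite lee_fin.
  apply: (minor_le_major _ mV) => //; last exact: ltW.
  exact: quadratic_primitive_major.
apply: ereal_sup_ubound; exists F => //.
exact: quadratic_primitive_minor.
Qed.

Lemma LP_integrable_primitive a b F f : a < b -> quadratic_primitive F f ->
  LP_integrable a b f.
Proof.
move=> ab qF; exists (F b - F a).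
by rewrite (lap_inf_primitive ab qF) (lap_sup_primitive ab qF).
Qed.

Lemma alex_norm_primitive_le a b F f (M : R) : quadratic_primitive F f ->
  (forall x, a < x <= b -> `|F x - F a| <= M) -> (alex_norm a b f <= M%:E)%E.
Proof.
move=> qF hM; apply: ge_ereal_sup => _ [x /= + <-].
rewrite in_itv/= => xab; rewrite lee_fin /LP_integral.
have /andP[ax _] := xab.
by rewrite (lap_inf_primitive ax qF)/=; exact: hM.
Qed.

(** [F - V] is a major function of [f - g], which gives the upper bound. For any major function [W]
    of [f - g], [W + U] is one of [f] and so dominates the minor function [F], which gives the lower
    bound. *)
Lemma LP_integral_subr_bounds a b F f g U V x : quadratic_primitive F f ->
  major a b g U -> minor a b g V -> a < x -> x <= b ->
  (F x - F a) - (U x - U a) <= LP_integral a x (fun z => f z - g z) <=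
  (F x - F a) - (V x - V a).
Proof.
move=> qF mU mV ax xb.
have ab : a < b by exact: lt_le_trans ax xb.
have ub : (lap_inf a x (fun z => f z - g z)%R <=
    ((F x - F a) - (V x - V a))%:E)%E.
  apply: ereal_inf_lbound; exists (fun z => F z + - V z);
    last by congr EFin; ring.
  apply: majorD => //; first exact: quadratic_primitive_major.
  exact: major_sub (lexx a) ax xb ((minorE g V ab).1 mV).
have lb : (((F x - F a) - (U x - U a))%:E <=
    lap_inf a x (fun z => f z - g z)%R)%E.
  apply: le_ereal_inf_tmp => _ [W mW <-]; rewrite lee_fin.
  have mWU := majorD ax mW (major_sub (lexx a) ax xb mU).
  have := @minor_le_major a x (fun z => f z - g z + g z) _ F a x mWU.
  have -> : (fun z => f z - g z + g z) = f by apply/funext => z; rewrite subrK.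
  move=> /(_ (quadratic_primitive_minor ax qF) (lexx _) (ltW ax) (lexx _)); lra.
(* The two real bounds exclude the infinite values, which [fine] would send to 0. *)
rewrite /LP_integral; move: lb ub.
by case: (lap_inf _ _ _) => [r| |]//=; rewrite !lee_fin => -> ->.
Qed.

Lemma alex_norm_lt a b f (e : R) x : (alex_norm a b f < e%:E)%E ->
  a < x -> x <= b -> `|LP_integral a x f| < e.
Proof.
move=> h ax xb; rewrite -lte_fin; apply: le_lt_trans h.
by apply: ereal_sup_ubound; exists x => //=; rewrite in_itv/= ax.
Qed.

Lemma LP_limit_bounds a b (F f : nat -> R -> R) g U V (e : R) : a < b ->
  (forall n, quadratic_primitive (F n) (f n)) -> LP_integrable a b g ->
  (forall eps : R, 0 < eps -> exists N : nat, forall n : nat, (N <= n)%N ->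
     (alex_norm a b (fun x => f n x - g x)%R < eps%:E)%E) ->
  major a b g U -> minor a b g V -> 0 < e ->
  exists N, forall n, (N <= n)%N -> forall x y, a <= x -> x <= y -> y <= b ->
    V y - V x - e <= F n y - F n x <= U y - U x + e.
Proof.
move=> ab qF [r [supE infE]] cvg mU mV e0.
have e30 : 0 < e / 3 by lra.
have e60 : 0 < e / 6 by lra.
have [N hN] := cvg _ e30; exists N => n /hN {}hN x y ax xy yb.
have bound U' V' z : major a b g U' -> minor a b g V' -> a <= z -> z <= b ->
    V' z - V' a - e / 3 <= F n z - F n a <= U' z - U' a + e / 3.
  move=> mU' mV'; rewrite le_eqVlt => /predU1P[<-|az] zb.
    by rewrite !subrr; apply/andP; split; lra.
  have := alex_norm_lt hN az zb; rewrite ltr_norml => /andP[h1 h2].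
  have /andP[h3 h4] := LP_integral_subr_bounds (qF n) mU' mV' az zb.
  by apply/andP; split; lra.
(* Convergence controls only increments from [a]; a pair [V'], [U'] whose total
   increments are [e / 3]-close transfers the bounds to any [x <= y]. *)
have [U' mU' hU'] : exists2 U', major a b g U' & U' b - U' a < r + e / 6.
  have : (lap_inf a b g < (r + e / 6)%:E)%E by rewrite infE lte_fin ltrDl.
  by move=> /ereal_inf_lt[_ [U' mU' <-]]; rewrite lte_fin; exists U'.
have [V' mV' hV'] : exists2 V', minor a b g V' & r - e / 6 < V' b - V' a.
  have : ((r - e / 6)%:E < lap_sup a b g)%E by rewrite supE lte_fin gtrBl.
  by move=> /ereal_sup_gt[_ [V' mV' <-]]; rewrite lte_fin; exists V'.
have xb := le_trans xy yb; have ay := le_trans ax xy.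
have /andP[x1 x2] := bound U' V' x mU' mV' ax xb.
have /andP[y1 y2] := bound U' V' y mU' mV' ay yb.
(* The error [e] is the sum of [e / 3] from the norm at [x], [e / 3] from the norm at [y], and the
   gap between [U'] and [V'] over [[a, b]]. *)
have h1 := minor_le_major mU' mV' (lexx a) ax xb.
have h2 := minor_le_major mU' mV' ay yb (lexx b).
have h3 := minor_le_major mU mV' ax xy yb.
have h4 := minor_le_major mU' mV ax xy yb.
have h5 := minor_le_major mU' mV' ax xy yb.
by apply/andP; split; lra.
Qed.

(** The Baire argument uses radius 1, which may reach beyond [b]; it is applied to the clamped
    extension, to which a change of radius from [b - x] to 1 carries the derivate bound. *)
Lemma major_increment_ge a b f U p q : major a b f U ->
  a <= p -> p < q -> q <= b ->
  exists p' q' M, [/\ p <= p', p' < q', q' <= q &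
    forall x y, p' <= x -> x <= y -> y <= q' -> M * (y - x) <= U y - U x].
Proof.
move=> mU ap pq qb; have ab : a < b by lra.
have [cU hU] := (majorP _ _ ab).1 mU.
have cW := continuous_comp_clamp (ltW ab) cU.
have [|p' [q' [M [pp' p'q' q'q h]]]] :=
    @exists_subinterval_increment_ge _ _ p q cW pq.
  move=> x /andP[px xq]; exists (f x).
  have bx0 : 0 < b - x by lra.
  have [|h _] := hU x; first by apply/andP; split; lra.
  have cr d : {within `[0, d], continuous (rinc (U \o clamp a b) x)}.
    by apply: continuous_subspaceT; exact: continuous_rinc.
  apply: (@lap_ge_delta _ (b - x)) => //.
  apply: eq_lap_ge (h _ bx0 (lexx _)) => t /andP[t0 tb].
  by rewrite /rinc/= !clamp_id//; apply/andP; split; lra.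
exists p', q', M; split=> // x y p'x xy yq'.
have := h x y p'x xy yq'.
by rewrite /= !clamp_id//; apply/andP; split; lra.
Qed.

(** The increments of [U] and of [- V] are both bounded below linearly on a common interval; where
    their sum is also bounded above linearly, so is each of them. *)
Lemma exists_right_lipschitz a b g U V : a < b ->
  major a b g U -> minor a b g V ->
  exists x z C, [/\ a <= x, x < z, z <= b & forall y, x <= y -> y <= z ->
    - (C * (y - x)) <= V y - V x /\ U y - U x <= C * (y - x)].
Proof.
move=> ab mU mV; have mV' := (minorE g V ab).1 mV.
have [p [q [M [ap pq qb hM]]]] := major_increment_ge mU (lexx a) ab (lexx b).
have [p' [q' [M' [pp' p'q' q'q hM']]]] := major_increment_ge mV' ap pq qb.
have ap' := le_trans ap pp'; have q'b := le_trans q'q qb.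
have [cUV _] := major_sub ap' p'q' q'b (majorD ab mU mV').
pose G x := U x + - V x.
(* One more than the chord slope, hence strictly above it. *)
pose c := (G q' - G p') / (q' - p') + 1.
have qp0 : 0 < q' - p' by rewrite subr_gt0.
have [|x /andP[p'x xq'] hx] := @exists_right_slope_le _ p' q' c _ p'q' cUV.
  by rewrite /c mulrDl divfK ?gt_eqF// mul1r ltrDl.
exists x, q', (`|c| + `|M| + `|M'|); split=> //; first exact: le_trans ap' p'x.
move=> y xy yq'.
have h1 := hM x y (le_trans pp' p'x) xy (le_trans yq' q'q).
have h2 := hM' x y p'x xy yq'.
have h3 := hx y; rewrite xy yq' in h3; have {}h3 := h3 isT.
have yx0 : 0 <= y - x by rewrite subr_ge0.
have b0 (k : R) : - (`|k| * (y - x)) <= k * (y - x) <= `|k| * (y - x).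
  by rewrite -mulNr !ler_wpM2r// ?lerNnormlW ?ler_norm.
have /andP[c1 c2] := b0 c; have /andP[c3 c4] := b0 M.
have /andP[c5 c6] := b0 M'.
have n1 : 0 <= `|M| * (y - x) by rewrite mulr_ge0.
have n2 : 0 <= `|M'| * (y - x) by rewrite mulr_ge0.
by rewrite !mulrDl; split; lra.
Qed.

End Integral.

(** * Partial sums of a Weierstrass series and their one-sided increments *)

Section Weierstrass.
Variable R : realType.
Implicit Types (x t C : R) (n k : nat).

(** The factor [2 * pi] makes [64 ^- k] a period of term [k] and of all later ones. With amplitudes
    [2 ^- k] the series converges uniformly, while slopes grow like [32 ^+ k], fast enough for each
    term to outweigh all earlier ones. *)
Definition wfreq k : R := 2 * pi * 64 ^+ k.
Definition wterm k x : R := sin (wfreq k * x) / 2 ^+ k.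
Definition wsum n x : R := \sum_(k < n) wterm k x.
Definition wsum' n x : R := \sum_(k < n) (wfreq k / 2 ^+ k * cos (wfreq k * x)).

Lemma wsumS n x : wsum n.+1 x = wsum n x + wterm n x.
Proof. by rewrite /wsum big_ord_recr. Qed.

Lemma wfreq_ge0 k : 0 <= wfreq k.
Proof. by rewrite /wfreq !mulr_ge0 ?pi_ge0 ?exprn_ge0. Qed.

Lemma sin_lipschitz (x y : R) : `|sin x - sin y| <= `|x - y|.
Proof.
wlog xy : x y / x <= y.
  move=> h; have [/h//|/ltW/h] := leP x y.
  by rewrite distrC [in leRHS]distrC.
have [|c _ h] := @MVT_segment R sin cos x y xy (fun z _ => is_derive_sin z).
  by apply: continuous_subspaceT; exact: continuous_sin.
rewrite -normrN opprB h normrM -[`|x - y|]normrN opprB.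
by rewrite ler_piMl// cos_max.
Qed.

Lemma cos_lipschitz (x y : R) : `|cos x - cos y| <= `|x - y|.
Proof.
wlog xy : x y / x <= y.
  move=> h; have [/h//|/ltW/h] := leP x y.
  by rewrite distrC [in leRHS]distrC.
have [|c _ h] := @MVT_segment R cos (fun z => - sin z) x y xy
    (fun z _ => is_derive_cos z).
  by apply: continuous_subspaceT; exact: continuous_cos.
rewrite -normrN opprB h normrM normrN -[`|x - y|]normrN opprB.
by rewrite ler_piMl// sin_max.
Qed.

(** The mean value theorem gives [cos c * t] with [c] within [t] of [x], and the cosine is
    1-Lipschitz. *)
Lemma sin_quadratic (x t : R) : `|sin (x + t) - sin x - cos x * t| <= t ^+ 2.
Proof.
have key (a b : R) : a <= b -> exists2 c, a <= c <= b &
    sin b - sin a = cos c * (b - a).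
  move=> ab; have [|c cI h] :=
      @MVT_segment R sin cos a b ab (fun z _ => is_derive_sin z).
    by apply: continuous_subspaceT; exact: continuous_sin.
  by exists c => //; rewrite in_itv in cI.
have [c hc ->] : exists2 c, `|c - x| <= `|t| &
    sin (x + t) - sin x = cos c * t.
  have [t0|t0] := leP 0 t.
    have [|c /andP[c1 c2] h] := key x (x + t); first by rewrite lerDl.
    exists c; last by rewrite h addrAC subrr add0r.
    by rewrite !ger0_norm//; lra.
  have [|c /andP[c1 c2] h] := key (x + t) x; first by rewrite gerDl ltW.
  exists c; last by rewrite -opprB h; ring.
  by rewrite !ler0_norm//; lra.
rewrite -mulrBl normrM -[t ^+ 2]real_normK ?num_real// expr2 ler_wpM2r//.
exact: le_trans (cos_lipschitz _ _) hc.
Qed.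

Lemma quadratic_primitive_wsum n : quadratic_primitive (wsum n) (wsum' n).
Proof.
elim: n => [|n IHn].
  have -> : wsum 0 = cst 0 by apply/funext => x; rewrite /wsum big_ord0.
  have -> : wsum' 0 = cst 0 by apply/funext => x; rewrite /wsum' big_ord0.
  split; first by move=> x; exact: cvg_cst.
  by exists 0 => // x t; rewrite /cst subrr mul0r subr0 normr0 mul0r.
have -> : wsum n.+1 = fun x => wsum n x + wterm n x.
  by apply/funext => x; rewrite wsumS.
have -> : wsum' n.+1 =
    fun x => wsum' n x + wfreq n / 2 ^+ n * cos (wfreq n * x).
  by apply/funext => x; rewrite /wsum' big_ord_recr.
apply: quadratic_primitiveD => //; split.
  move=> x; apply: (@continuousM _ _ (fun x => sin (wfreq n * x))
    (cst (2 ^+ n)^-1)).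
    apply: (@continuous_comp R R R ( *%R (wfreq n)) sin).
      exact: mulrl_continuous.
    exact: continuous_sin.
  exact: cvg_cst.
exists (wfreq n ^+ 2 / 2 ^+ n) => [|x t].
  by rewrite divr_ge0 ?exprn_ge0 ?wfreq_ge0.
have -> : wterm n (x + t) - wterm n x - wfreq n / 2 ^+ n * cos (wfreq n * x) * t
   = (sin (wfreq n * x + wfreq n * t) - sin (wfreq n * x) -
      cos (wfreq n * x) * (wfreq n * t)) / 2 ^+ n.
  by rewrite /wterm mulrDr; ring.
rewrite normrM normfV (ger0_norm (exprn_ge0 _ _))//.
rewrite [leRHS]mulrAC ler_wpM2r ?invr_ge0 ?exprn_ge0//.
by rewrite -exprMn; exact: sin_quadratic.
Qed.

Lemma wsum0 n : wsum n 0 = 0.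
Proof. by rewrite /wsum big1// => k _; rewrite /wterm mulr0 sin0 mul0r. Qed.

(** The right side is the exact geometric sum of the amplitudes, a form in which the induction
    closes. *)
Lemma wsumD_le n k x :
  `|wsum (n + k) x - wsum n x| <= 2 / 2 ^+ n - 2 / 2 ^+ (n + k).
Proof.
elim: k => [|k IHk]; first by rewrite addn0 !subrr normr0.
have -> : wsum (n + k.+1) x - wsum n x =
    (wsum (n + k) x - wsum n x) + wterm (n + k) x.
  by rewrite addnS wsumS; ring.
apply: (le_trans (ler_normD _ _)); apply: (le_trans (lerD IHk (lexx _))).
rewrite -addrA lerD2l addnS exprS /wterm.
rewrite normrM normfV (ger0_norm (exprn_ge0 _ _))//.
set P := 2 ^+ (n + k); have P0 : 0 < P by rewrite exprn_gt0.
have -> : - (2 / (2 * P)) = - (2 / P) + P^-1 by field; rewrite gt_eqF.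
by rewrite lerD2l ler_piMl ?invr_ge0 ?(ltW P0)// sin_max.
Qed.

Lemma wsum_cauchy N m n x : (N <= m)%N -> (N <= n)%N ->
  `|wsum m x - wsum n x| <= 4 / 2 ^+ N.
Proof.
have key k : (N <= k)%N -> `|wsum k x - wsum N x| <= 2 / 2 ^+ N.
  move=> /subnKC <-; apply: (le_trans (wsumD_le _ _ _)).
  by rewrite gerBl divr_ge0 ?exprn_ge0.
move=> /key h1 /key h2.
have -> : wsum m x - wsum n x =
    (wsum m x - wsum N x) - (wsum n x - wsum N x) by ring.
by apply: (le_trans (ler_normB _ _)); lra.
Qed.

(** Term [j] has slope at most [2 * pi * 32 ^+ j], and these sum to less than
    [2 * pi * 32 ^+ k / 31]. *)
Lemma wsum_lipschitz k x t : 0 <= t ->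
  `|wsum k (x + t) - wsum k x| <= 2 * pi * t * 32 ^+ k / 31.
Proof.
move=> t0; have pt0 : 0 <= 2 * pi * t :> R by rewrite !mulr_ge0 ?pi_ge0.
elim: k => [|k IHk].
  by rewrite /wsum !big_ord0 subrr normr0 divr_ge0// mulr_ge0// expr0.
have -> : wsum k.+1 (x + t) - wsum k.+1 x =
    (wsum k (x + t) - wsum k x) + (wterm k (x + t) - wterm k x).
  by rewrite !wsumS; ring.
apply: (le_trans (ler_normD _ _)); apply: (le_trans (lerD IHk (lexx _))).
have h : `|wterm k (x + t) - wterm k x| <= 2 * pi * t * 32 ^+ k.
  rewrite /wterm -mulrBl normrM normfV (ger0_norm (exprn_ge0 _ _))//.
  rewrite ler_pdivrMr ?exprn_gt0//; apply: (le_trans (sin_lipschitz _ _)).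
  rewrite -mulrBr addrAC subrr add0r ger0_norm ?(mulr_ge0 (wfreq_ge0 k) t0)//.
  have e64 : 64 ^+ k = 32 ^+ k * 2 ^+ k :> R.
    by rewrite -exprMn; congr (_ ^+ _); ring.
  by rewrite le_eqVlt; apply/orP; left; apply/eqP; rewrite /wfreq e64; ring.
have e32 : 32 ^+ k.+1 = 32 * 32 ^+ k :> R by rewrite exprS.
rewrite e32; lra.
Qed.

(** Such a [t] is a period of every term of index above [k]. *)
Lemma wsum_period k n x t : (k < n)%N ->
  (exists m : nat, 64 ^+ k.+1 * t = m%:R) ->
  wsum n (x + t) - wsum n x = wsum k.+1 (x + t) - wsum k.+1 x.
Proof.
move=> /subnKC <- [m hm]; elim: (n - k.+1)%N => [|i IHi].
  by rewrite addn0.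
rewrite addnS (wsumS (k.+1 + i) (x + t)) (wsumS (k.+1 + i) x).
suff -> : wterm (k.+1 + i) (x + t) = wterm (k.+1 + i) x.
  by rewrite -IHi; ring.
rewrite /wterm; congr (_ / _).
have -> : wfreq (k.+1 + i) * (x + t) =
    wfreq (k.+1 + i) * x + pi *+ 2 *+ (64 ^ i * m).
  rewrite mulrDr; congr (_ + _); rewrite /wfreq exprD.
  transitivity (2 * pi * 64 ^+ i * (64 ^+ k.+1 * t)); first by ring.
  by rewrite hm -[RHS]mulr_natr -[pi *+ 2]mulr_natr natrM natrX; ring.
exact: (periodicn (@sinD2pi R)).
Qed.

(** The first change is [2 * sin x] in absolute value; when the sine is small, the cosine is large
    and so is the second change, [cos x - sin x]. *)
Lemma sin_shift x : 1 / 2 <= `|sin (x + pi) - sin x| \/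
  1 / 2 <= `|sin (x + pi / 2) - sin x|.
Proof.
have [h|h] := leP (1 / 4) `|sin x|.
  left; rewrite sinDpi; have -> : - sin x - sin x = - (2 * sin x) by ring.
  by rewrite normrN normrM ger0_norm//; lra.
right; rewrite sinDpihalf.
have hc : 3 / 4 <= `|cos x|.
  rewrite -ler_sqr ?nnegrE; [|lra|exact: normr_ge0].
  rewrite real_normK ?num_real// cos2sin2.
  have := normr_ge0 (sin x); rewrite -[sin x ^+ 2]real_normK ?num_real//.
  by nra.
have := lerB_dist (cos x) (sin x); lra.
Qed.

(** The step [t] is chosen before [n], so the same large increment persists in all later partial
    sums. *)
Lemma wsum_nowhere_lipschitz x C (e : R) : 0 < e ->
  exists2 t, 0 < t <= e &
    exists k, forall n, (k < n)%N -> C * t < `|wsum n (x + t) - wsum n x|.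
Proof.
move=> e0.
have C0 := normr_ge0 C; have CC := ler_norm C.
have ie0 : 0 < e^-1 by rewrite invr_gt0.
(* The summand [2 * C] lets term [k] outweigh [C * t]; the summand [e^-1] ensures [t <= e]. *)
pose k := Num.bound (2 * `|C| + e^-1).
have hk : 2 * `|C| + e^-1 < 32 ^+ k :> R.
  apply: (@lt_le_trans _ _ (k%:R : R)).
    by apply: archi_boundP; lra.
  by rewrite -natrX ler_nat ltnW// ltn_expl.
(* For [t] a quarter or a half of the period [1 / P] of term [k], the later terms
   do not move, and the earlier ones move much less than term [k]. *)
pose P : R := 64 ^+ k.
have P32 : 32 ^+ k * 2 ^+ k = P by rewrite /P -exprMn; congr (_ ^+ _); ring.
have k20 : 1 <= 2 ^+ k :> R by apply: exprn_ege1; lra.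
have k320 : 1 <= 32 ^+ k :> R by apply: exprn_ege1; lra.
have P0 : 0 < P by rewrite exprn_gt0.
have pi0 := pi_gt0 R.
have pi4 : pi < 4 :> R by have /andP[_] := pihalf_02 R; lra.
have [t [t0 tP [m hm]] hs] : exists2 t : R, [/\ 0 < t, t * (2 * P) <= 1 &
    exists m : nat, 64 ^+ k.+1 * t = m%:R] &
    1 / 2 <= `|sin (wfreq k * (x + t)) - sin (wfreq k * x)|.
  have [h|h] := sin_shift (wfreq k * x).
    exists (2 * P)^-1; first split.
    - by rewrite invr_gt0 mulr_gt0.
    - by rewrite mulVf// mulf_neq0// gt_eqF.
    - by exists 32%N; rewrite exprS -/P; field; rewrite gt_eqF.
    suff -> : wfreq k * (x + (2 * P)^-1) = wfreq k * x + pi by [].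
    by rewrite /wfreq -/P; field; rewrite gt_eqF.
  exists (4 * P)^-1; first split.
  - by rewrite invr_gt0 mulr_gt0.
  - rewrite invfM; have -> : 4^-1 * P^-1 * (2 * P) = 1 / 2.
      by field; rewrite gt_eqF.
    by lra.
  - by exists 16%N; rewrite exprS -/P; field; rewrite gt_eqF.
  suff -> : wfreq k * (x + (4 * P)^-1) = wfreq k * x + pi / 2 by [].
  by rewrite /wfreq -/P; field; rewrite gt_eqF.
exists t.
  rewrite t0/= -[e]invrK -[t]invrK lef_pV2 ?posrE ?invr_gt0//.
  have : 2 * P <= t^-1 by rewrite -[t^-1]mul1r ler_pdivlMr// mulrC.
  nra.
exists k => n kn; rewrite (wsum_period _ kn); last by exists m.
have -> : wsum k.+1 (x + t) - wsum k.+1 x =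
    (wterm k (x + t) - wterm k x) - - (wsum k (x + t) - wsum k x).
  by rewrite !wsumS; ring.
apply: lt_le_trans (lerB_dist _ _); rewrite normrN.
have h1 := wsum_lipschitz k x (ltW t0).
have h2 : 1 / 2 / 2 ^+ k <= `|wterm k (x + t) - wterm k x|.
  rewrite /wterm -mulrBl normrM normfV (ger0_norm (exprn_ge0 _ _))//.
  by rewrite ler_wpM2r ?invr_ge0 ?exprn_ge0.
(* After multiplication by [2 ^+ k], the first summand is at most [1 / 4] and the second at most
   [pi / 31 < 1 / 4]. *)
suff h3 : C * t + 2 * pi * t * 32 ^+ k / 31 < 1 / 2 / 2 ^+ k by lra.
rewrite ltr_pdivlMr ?exprn_gt0// mulrDl.
have h4 : C * t * 2 ^+ k <= 1 / 4.
  apply: (@le_trans _ _ (`|C| * t * 2 ^+ k)).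
    by rewrite ler_wpM2r ?exprn_ge0// ler_wpM2r// ltW.
  have : 2 * `|C| * (t * 2 ^+ k) <= 32 ^+ k * (t * 2 ^+ k).
    by rewrite ler_wpM2r ?mulr_ge0 ?exprn_ge0 ?(ltW t0)//; lra.
  have -> : 32 ^+ k * (t * 2 ^+ k) = t * P by rewrite -P32; ring.
  by lra.
have -> : 2 * pi * t * 32 ^+ k / 31 * 2 ^+ k = pi / 31 * (t * (2 * P)).
  by rewrite -P32; ring.
have : pi / 31 * (t * (2 * P)) <= pi / 31 by rewrite ler_piMr// divr_ge0 ?ltW.
lra.
Qed.

End Weierstrass.

(* (LP[0,1], ||.||_[0,1]) is not complete: there is a Cauchy sequence of
   Laplace integrable functions which converges to no Laplace integrable
   function (elements of the quotient by a.e. equality are represented by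
   functions; the seminorm is constant on classes). *)
Theorem theorem5p10 (R : realType) :
  exists f : nat -> R -> R,
    (forall n, LP_integrable 0 1 (f n)) /\
    (forall eps : R, 0 < eps -> exists N : nat, forall m n : nat,
        (N <= m)%N -> (N <= n)%N ->
        (alex_norm 0 1 (fun x => (f m x - f n x)%R) < eps%:E)%E) /\
    ~ (exists g : R -> R, LP_integrable 0 1 g /\
        (forall eps : R, 0 < eps -> exists N : nat, forall n : nat,
            (N <= n)%N -> (alex_norm 0 1 (fun x => (f n x - g x)%R) < eps%:E)%E)).
Proof.
exists (@wsum' R); split; [|split].
- move=> n; apply: LP_integrable_primitive ltr01 _.
  exact: quadratic_primitive_wsum.
(* [2 ^+ N > N > 4 / eps] makes the uniform tail bound [4 / 2 ^+ N] smaller than [eps]. *)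
- move=> eps eps0; exists (Num.bound (4 / eps)) => m n.
  set N := Num.bound _ => Nm Nn.
  have hN : 4 / 2 ^+ N < eps.
    rewrite ltr_pdivrMr ?exprn_gt0// mulrC -ltr_pdivrMr//.
    apply: (@lt_le_trans _ _ (N%:R : R)).
      by apply: archi_boundP; rewrite divr_ge0// ltW.
    by rewrite -natrX ler_nat ltnW// ltn_expl.
  apply: le_lt_trans (_ : _ <= (4 / 2 ^+ N)%:E)%E _; last by rewrite lte_fin.
  apply: (alex_norm_primitive_le (F := fun x => wsum m x + - wsum n x)).
    apply: quadratic_primitiveD; first exact: quadratic_primitive_wsum.
    exact/quadratic_primitiveN/quadratic_primitive_wsum.
  by move=> x _; rewrite !wsum0 !subr0; exact: wsum_cauchy.
move=> [g [gLP cvg]]; have [r [supE infE]] := gLP.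
have [U mU] : exists U, major 0 1 g U.
  have : (lap_inf 0 1 g < (r + 1)%:E)%E by rewrite infE lte_fin ltrDl.
  by move=> /ereal_inf_lt[? [U mU _] _]; exists U.
have [V mV] : exists V, minor 0 1 g V.
  have : ((r - 1)%:E < lap_sup 0 1 g)%E by rewrite supE lte_fin gtrBl.
  by move=> /ereal_sup_gt[? [V mV _] _]; exists V.
have [x [z [C [x0 xz z1 UV]]]] := exists_right_lipschitz ltr01 mU mV.
have zx0 : 0 < z - x by rewrite subr_gt0.
(* The constant [C + 1] leaves room for the approximation error [t / 2]: the squeeze bounds the
   increment by [C * t + t / 2 < (C + 1) * t]. *)
have [t /andP[t0 tz] [k hk]] := wsum_nowhere_lipschitz x (C + 1) zx0.
have t20 : 0 < t / 2 by rewrite divr_gt0.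
have [N hN] := LP_limit_bounds ltr01 (@quadratic_primitive_wsum R) gLP cvg
  mU mV t20.
have xxt : x <= x + t by rewrite lerDl ltW.
have xtz : x + t <= z by lra.
have /andP[h1 h2] := hN (maxn N k.+1) (leq_maxl _ _) x (x + t) x0 xxt
  (le_trans xtz z1).
have [h3 h4] := UV (x + t) xxt xtz; rewrite addrAC subrr add0r in h3 h4.
have := hk (maxn N k.+1) (leq_maxr _ _); rewrite ltNge => /negP; apply.
by rewrite ler_norml; apply/andP; split; lra.
Qed.
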